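(* Let $R$ be a Rickart *-ring with proper involution. Elements $a$ and $b$ of $R$ have a meet $a\curlywedge b$ in $(R,\preceq)$ if and only if the set of projections $\{u'' : u\in R,\ u\preceq a \text{ and } u\preceq b\}$ has a greatest element $m$. If this is the case, then $m=(a\curlywedge b)''$ and $a\curlywedge b=am=bm$.
   Context: A *-ring is an associative ring $R$ with an involution $x\mapsto x^*$ (additive, $(xy)^*=y^*x^*$, $x^{**}=x$). A projection is an element $e$ with $e^2=e=e^*$; $P$ denotes the set of projections of $R$, ordered by $e\le f$ iff $ef=e$ (iff $fe=e$). $R$ is a Rickart *-ring if the right annihilator of every element is generated by a projection, i.e. to each $x\in R$ there is a (necessarily unique) projection $x'$ such that for all $y\in R$: $xy=0$ iff $y=x'y$. Then $R$ has the unit $1:=0'$, and $e'=1-e$ for $e\in P$. Write $x'':=(x')'$. Elements $x,y$ are *-orthogonal, $x\perp y$, if $xy^*=0=x^*y$. The involution is proper if $x^*x=0$ implies $x=0$. The star order on $R$ is the partial order defined by: $x\preceq y$ iff $x\perp y-x$; equivalently, $x^*x=x^*y$ and $xx^*=yx^*$. On $P$ the star order coincides with $\le$. The symbol $\curlywedge$ denotes the (in general partial) meet (greatest lower bound) in $(R,\preceq)$. *)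

(* Defs.v *)
From HB Require Import structures.
From mathcomp Require Import all_boot ssralg.

Set Implicit Arguments.
Unset Strict Implicit.
Unset Printing Implicit Defensive.

Import GRing.Theory.
Local Open Scope ring_scope.

HB.mixin Record PzRing_hasInvolution R of GRing.PzRing R := {
  star : R -> R;
  starD : {morph star : x y / x + y >-> x + y};
  starM : {morph star : x y / x * y >-> y * x};
  starK : involutive star
}.

(* Carried by pzRingType, so the trivial ring is allowed. *)
#[short(type="starRingType")]
HB.structure Definition StarRing :=
  {R of GRing.PzRing R & PzRing_hasInvolution R}.

Notation "x ^*" := (star x) : ring_scope.

Definition projection (R : starRingType) (e : R) : bool :=
  (e * e == e) && (e == e^*).

(* A ring carrying an operation [rann] as below has the unit [rann 0], so      *)
(* taking the underlying ring unital loses no generality. The projection       *)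
(* [rann x], usually written x', is determined by x, so recording it as an     *)
(* operation rather than by its existence adds no data.                        *)
HB.mixin Record StarRing_isRickart R of StarRing R := {
  rann : R -> R;
  rann_projection : forall x : R, projection (rann x);
  rannP : forall x y : R, x * y = 0 <-> y = rann x * y
}.

#[short(type="rickartStarRingType")]
HB.structure Definition RickartStarRing :=
  {R of StarRing R & StarRing_isRickart R}.

Definition rsupp (R : rickartStarRingType) (x : R) : R := rann (rann x).

Definition proper_involution (R : starRingType) : Prop :=
  forall x : R, x^* * x = 0 -> x = 0.

Definition star_orth (R : starRingType) (x y : R) : bool :=
  (x * y^* == 0) && (x^* * y == 0).

Definition star_le (R : starRingType) (x y : R) : bool := star_orth x (y - x).

(* The order of projections; not a preorder outside of them. *)
Definition proj_le (R : starRingType) (e f : R) : bool := e * f == e.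

Definition is_greatest (T : Type) (le : rel T) (S : T -> Prop) (m : T) : Prop :=
  S m /\ forall x, S x -> le x m.

Definition is_star_meet (R : starRingType) (a b c : R) : Prop :=
  is_greatest (@star_le R) (fun u => star_le u a /\ star_le u b) c.

Definition lower_supports (R : rickartStarRingType) (a b p : R) : Prop :=
  exists u : R, [/\ star_le u a, star_le u b & p = rsupp u].

(* Main.v *)
Require Import Defs.
From mathcomp Require Import all_boot ssralg.
Local Open Scope ring_scope.

(** If [u] lies below [a] in the star order, then [u = a u'']; hence a lower
    bound [u] of [a] and [b] is determined by [u''].  Moreover, for [u] and [v]
    below [a], one has [v] below [u] if and only if [v'' <= u'']: the direct
    implication uses that the involution is proper, the converse is a
    computation with [u = a u''] and [v = a v'']. *)

Import GRing.Theory.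

Lemma star0 (R : starRingType) : (0 : R)^* = 0.
Proof. by apply: (addrI ((0 : R)^*)); rewrite -starD !addr0. Qed.

Lemma starB (R : starRingType) : {morph @star R : x y / x - y}.
Proof. by move=> x y; apply: (addIr (y^*)); rewrite -starD !subrK. Qed.

Lemma projectionP (R : starRingType) (e : R) :
  reflect (e * e = e /\ e^* = e) (projection e).
Proof.
by apply: (iffP andP) => [[/eqP ee /eqP es]|[ee es]]; last rewrite ee es.
Qed.

Lemma star_leP (R : starRingType) (x y : R) :
  reflect (x * y^* = x * x^* /\ x^* * y = x^* * x) (star_le x y).
Proof.
rewrite /star_le /star_orth starB !mulrBr !subr_eq0.
by apply: (iffP andP) => [[/eqP-> /eqP->]|[-> ->]].
Qed.

(** Applying the involution to [e * f = e] gives [f * e = e], while the second inequality gives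
    [f * e = f]. *)
Lemma proj_le_anti (R : starRingType) (e f : R) :
  projection e -> projection f -> proj_le e f -> proj_le f e -> e = f.
Proof.
move=> /projectionP[_ es] /projectionP[_ fs] /eqP ef /eqP fe.
by rewrite -[LHS]es -ef starM es fs.
Qed.

Section RickartStarRing.
Variable R : rickartStarRingType.
Implicit Types a b c e u v x y : R.

Lemma mul_rann x : x * rann x = 0.
Proof. by apply/rannP; case/projectionP: (rann_projection x). Qed.

(** Since [e * (1 - e) = 0], the element [1 - e] is fixed by left multiplication by [rann e]; and
    [rann e * e = 0], being the adjoint of [e * rann e = 0]. *)
Lemma rann_proj e : projection e -> rann e = 1 - e.
Proof.
move=> /projectionP[ee es]; have /projectionP[_ rs] := rann_projection e.
have re : rann e * e = 0.
  by rewrite -[LHS]starK starM es rs mul_rann star0.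
have: e * (1 - e) = 0 by rewrite mulrBr mulr1 ee subrr.
by move/rannP; rewrite mulrBr mulr1 re subr0.
Qed.

Lemma rsuppE x : rsupp x = 1 - rann x.
Proof. exact/rann_proj/rann_projection. Qed.

Lemma rsupp_projection x : projection (rsupp x).
Proof. exact: rann_projection. Qed.

Lemma star_rsupp x : (rsupp x)^* = rsupp x.
Proof. by case/projectionP: (rsupp_projection x). Qed.

Lemma mul_rsupp x : x * rsupp x = x.
Proof. by rewrite rsuppE mulrBr mulr1 mul_rann subr0. Qed.

Lemma mul_eq0_rsupp x y : x * y = 0 -> rsupp x * y = 0.
Proof. by move/rannP => xy; rewrite rsuppE mulrBl mul1r -xy subrr. Qed.

(** Only left factors can be replaced by their supports, so adjoints are taken to swap sides:
    [x'' y^* = 0], then [y x'' = 0], [y'' x'' = 0] and [x'' y'' = 0]; finally [x = x x'']. *)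
Lemma mul_star_eq0_rsupp x y : x * y^* = 0 -> x * rsupp y = 0.
Proof.
move=> /mul_eq0_rsupp/(congr1 (@star R)).
rewrite starM starK star0 star_rsupp => /mul_eq0_rsupp/(congr1 (@star R)).
rewrite starM !star_rsupp star0 => xy0.
by rewrite -[x]mul_rsupp -mulrA xy0 mulr0.
Qed.

Lemma star_le_rsupp u a : star_le u a -> u = a * rsupp u.
Proof.
move=> /star_leP[/(congr1 (@star R)) ua _]; move: ua.
rewrite !starM !starK => ua.
(* Here [u^*] may be replaced by [u''], and [u u'' = u]. *)
have: (a - u) * u^* = 0 by rewrite mulrBl ua subrr.
by move/mul_star_eq0_rsupp/eqP; rewrite mulrBl mul_rsupp subr_eq0 => /eqP.
Qed.

Lemma rsupp_le u c :
  proper_involution R -> star_le u c -> proj_le (rsupp u) (rsupp c).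
Proof.
move=> hR /star_leP[_ uc].
have /mul_eq0_rsupp uc0 : u * rann c = 0.
  (* Properness applied to [u c']: in its adjoint times itself, [u^* u] becomes [u^* c], and
     [c c' = 0]. *)
  apply: hR; rewrite starM -mulrA [u^* * _]mulrA -uc.
  by rewrite -[u^* * c * _]mulrA mul_rann !mulr0.
by rewrite /proj_le [rsupp c]rsuppE mulrBr mulr1 uc0 subr0.
Qed.

Lemma star_le_of_rsupp_le a u v : star_le u a -> star_le v a ->
  proj_le (rsupp v) (rsupp u) -> star_le v u.
Proof.
move=> /star_le_rsupp uE va /eqP vu; have vE := star_le_rsupp _ _ va.
(* Once [u] is written as [a u''], this absorption reduces both conditions for [v] below [u] to
   those for [v] below [a]. *)
have vuv : v * rsupp u = v by rewrite -[v]mul_rsupp -mulrA vu.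
case/star_leP: va => va1 va2; apply/star_leP; split.
  by rewrite [in LHS]uE starM star_rsupp mulrA vuv va1.
by rewrite [in LHS]uE mulrA va2 -mulrA vuv.
Qed.

Lemma star_meet_greatest_rsupp a b c : proper_involution R ->
  is_star_meet a b c ->
  is_greatest (@proj_le R) (lower_supports a b) (rsupp c).
Proof.
move=> hR [[ca cb] cmax]; split; first by exists c.
by move=> _ [u [ua ub ->]]; apply: rsupp_le => //; apply: cmax.
Qed.

Lemma greatest_rsupp_star_meet a b u : star_le u a -> star_le u b ->
  is_greatest (@proj_le R) (lower_supports a b) (rsupp u) ->
  is_star_meet a b u.
Proof.
move=> ua ub [_ umax]; split=> // v [va vb].
by apply: (star_le_of_rsupp_le _ _ _ ua va); apply: umax; exists v.
Qed.

End RickartStarRing.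

Theorem theorem5p2 (R : rickartStarRingType) (hR : proper_involution R)
    (a b : R) :
  ((exists c : R, is_star_meet a b c) <->
   (exists m : R, is_greatest (@proj_le R) (lower_supports a b) m)) /\
  (forall m c : R,
     is_greatest (@proj_le R) (lower_supports a b) m ->
     is_star_meet a b c ->
     [/\ m = rsupp c, c = a * m & c = b * m]).
Proof.
split; first split=> [[c cP]|[m mP]].
- by exists (rsupp c); apply: star_meet_greatest_rsupp.
(* The lower bound whose support is [m] is itself the meet. *)
- have [[u [ua ub mE]] _] := mP; exists u.
  by apply: greatest_rsupp_star_meet; rewrite -?mE.
move=> m c [mS mmax] cP.
have [cS cmax] := star_meet_greatest_rsupp _ _ _ _ hR cP.
have [[ca cb] _] := cP.
have mE : m = rsupp c.
  (* Both elements are greatest; antisymmetry also requires [m] to be a projection, which it is as a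
     support. *)
  apply: proj_le_anti (cmax _ mS) (mmax _ cS); last exact: rsupp_projection.
  by case: mS => u [_ _ ->]; apply: rsupp_projection.
by rewrite mE; split=> //; apply: star_le_rsupp.
Qed.
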